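(* Let $S>0$. For any $\alpha<0$, there exist positive constants $a_1=a_1(\alpha)$, $c_1=c_1(\alpha)$ and $c_2=c_2(\alpha)$ such that $$\lambda_{a,c}<\lambda_0$$ holds under any of the following restrictions: (i) $|a|>a_1$ and $c>0$; (ii) $a\in\mathbb{R}$ and $c>c_1$; (iii) $a\in\mathbb{R}$ and $0<c<c_2$.
   Context: For a bounded Lipschitz domain $\Omega\subset\mathbb{R}^2$ and $\alpha\in\mathbb{R}$, the lowest Robin eigenvalue is $$\lambda_1^\alpha(\Omega)=\inf_{u\in H^1(\Omega),\,u\neq0}\frac{\int_\Omega|\nabla u|^2+\alpha\int_{\partial\Omega}|u|^2}{\int_\Omega|u|^2},$$ with the boundary integral understood in the sense of traces. The area $S>0$ is fixed (the constants may depend on it). For $a\in\mathbb{R}$ and $c>0$, $\Omega_{a,c}$ denotes the (open) triangle with vertices $(-c,0)$, $(c,0)$ and $(a,S/c)$, which has area $S$. With $c_0:=\sqrt{S/\sqrt3}$, $\Omega_0:=\Omega_{0,c_0}$ is the equilateral triangle of area $S$. Write $\lambda_{a,c}:=\lambda_1^\alpha(\Omega_{a,c})$ and $\lambda_0:=\lambda_1^\alpha(\Omega_0)$. *)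

(* Defs.v *)
From HB Require Import structures.
From mathcomp Require Import all_boot all_order all_algebra.
From mathcomp Require Import all_classical all_reals all_analysis.
From mathcomp Require Import measurable_realfun.

Set Implicit Arguments.
Unset Strict Implicit.
Unset Printing Implicit Defensive.

Import Order.TTheory GRing.Theory Num.Theory numFieldNormedType.Exports.

Local Open Scope classical_set_scope.
Local Open Scope ring_scope.

(* measurableTypeR R is R with its Borel sigma-algebra, the type on which
   lebesgue_measure lives. *)
Notation plane R := (measurableTypeR R * measurableTypeR R)%type.

Definition area {R : realType} : {measure set (plane R) -> \bar R} :=
  (@lebesgue_measure R \x @lebesgue_measure R)%E.

Fixpoint Ck {R : realType} (k : nat) (f : R * R -> R) : Prop :=
  match k with
  | 0 => continuous f
  | k'.+1 => [/\ continuous f,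
      forall p, derivable f p (1, 0) /\ derivable f p (0, 1),
      Ck k' ('D_(1, 0) f) & Ck k' ('D_(0, 1) f)]
  end.

Definition smooth {R : realType} (f : R * R -> R) : Prop := forall k, Ck k f.

Definition test_function {R : realType} (Omega : set (R * R))
    (phi : R * R -> R) : Prop :=
  let supp := closure [set p | phi p != 0] in
  [/\ smooth phi, compact supp & supp `<=` Omega].

Definition sq_integrable {R : realType} (mu : {measure set (plane R) -> \bar R})
    (D : set (R * R)) (u : R * R -> R) : Prop :=
  measurable_fun D (u : plane R -> R) /\ (\int[mu]_(p in D) (u p ^+ 2)%:E < +oo)%E.

Definition weak_derivative {R : realType} (Omega : set (R * R)) (e : R * R)
    (u g : R * R -> R) : Prop :=
  forall phi, test_function Omega phi ->
    \int[area]_(p in Omega) (u p * 'D_e phi p) =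
    - \int[area]_(p in Omega) (g p * phi p).

(* u is in H^1(Omega), with weak gradient (g1, g2); functions matter only
   through their values almost everywhere on Omega. *)
Definition H1_with_gradient {R : realType} (Omega : set (R * R))
    (u g1 g2 : R * R -> R) : Prop :=
  [/\ sq_integrable area Omega u,
      sq_integrable area Omega g1 /\ sq_integrable area Omega g2,
      weak_derivative Omega (1, 0) u g1 & weak_derivative Omega (0, 1) u g2].

(* sigma is the arc length measure of the boundary of Omega.  The trace operator
   H^1(Omega) -> L^2(sigma) is the continuous extension of the restriction
   v |-> v|_(boundary) from the functions smooth up to the boundary, which are
   dense in H^1(Omega) when Omega is a bounded Lipschitz domain. *)
Definition is_trace {R : realType} (Omega : set (R * R))
    (sigma : {measure set (plane R) -> \bar R}) (u g1 g2 w : R * R -> R) : Prop :=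
  sq_integrable sigma setT w /\
  exists v : nat -> R * R -> R,
  [/\ forall n, smooth (v n),
      (\int[area]_(p in Omega) ((v n p - u p) ^+ 2)%:E @[n --> \oo]
         --> 0)%E,
      (\int[area]_(p in Omega)
         (('D_(1, 0) (v n) p - g1 p) ^+ 2 +
          ('D_(0, 1) (v n) p - g2 p) ^+ 2)%:E @[n --> \oo] --> 0)%E
    & (\int[sigma]_p ((v n p - w p) ^+ 2)%:E @[n --> \oo] --> 0)%E].

(* The infimum is taken in \bar R.  For a bounded Lipschitz domain every u in
   H^1(Omega) has exactly one weak gradient (g1, g2) and one trace w, up to null
   sets, so that each nonzero u contributes exactly one value. *)
Definition robin_eigenvalue {R : realType} (Omega : set (R * R))
    (sigma : {measure set (plane R) -> \bar R}) (alpha : R) : \bar R :=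
  ereal_inf [set r : \bar R | exists u g1 g2 w : R * R -> R,
    [/\ H1_with_gradient Omega u g1 g2,
        ~ {ae area, forall p, Omega p -> u p = 0},
        is_trace Omega sigma u g1 g2 w &
        r = ((\int[area]_(p in Omega) (g1 p ^+ 2 + g2 p ^+ 2) +
              alpha * \int[sigma]_p (w p ^+ 2)) /
             \int[area]_(p in Omega) (u p ^+ 2))%:E]].

Definition triangle {R : realType} (A B C : R * R) : set (R * R) :=
  [set p | exists s t r : R, [/\ 0 < s, 0 < t, 0 < r, s + t + r = 1 &
    p = (s * A.1 + t * B.1 + r * C.1, s * A.2 + t * B.2 + r * C.2)]].

Definition segment_path {R : realType} (A B : R * R)
    (t : measurableTypeR R) : plane R :=
  (A.1 + t * (B.1 - A.1), A.2 + t * (B.2 - A.2)).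

Lemma measurable_segment_path {R : realType} (A B : R * R) :
  measurable_fun setT (segment_path A B).
Proof.
by apply: measurable_fun_pair; apply: measurable_funD => //;
  apply: measurable_funM.
Qed.

Definition segment_length {R : realType} (A B : R * R) : R :=
  Num.sqrt ((B.1 - A.1) ^+ 2 + (B.2 - A.2) ^+ 2).

Lemma segment_length_ge0 {R : realType} (A B : R * R) :
  0 <= segment_length A B.
Proof. exact: sqrtr_ge0. Qed.

Lemma measurable_unit_itv {R : realType} :
  measurable (`[0, 1] : set (measurableTypeR R)).
Proof. exact: measurable_itv. Qed.

(* Arc length on the segment [A, B]: the image of |B - A| dt on [0, 1]. *)
Definition segment_measure {R : realType} (A B : R * R) :
    set (plane R) -> \bar R :=
  pushforward
    (mscale (NngNum (segment_length_ge0 A B))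
       (mrestr (@lebesgue_measure R) measurable_unit_itv))
    (segment_path A B).

Section segment_measure_is_measure.
Context {R : realType} (A B : R * R).

Let segment_measure0 : segment_measure A B set0 = 0%E.
Proof. by rewrite /segment_measure /pushforward preimage_set0 measure0. Qed.

Let segment_measure_ge0 X : (0 <= segment_measure A B X)%E.
Proof. by rewrite /segment_measure /pushforward; exact: measure_ge0. Qed.

Let segment_measure_sigma_additive : semi_sigma_additive (segment_measure A B).
Proof.
move=> F mF tF mUF.
by apply: measure_semi_sigma_additive; first exact: measurable_segment_path.
Qed.

HB.instance Definition _ := isMeasure.Build _ _ _ (segment_measure A B)
  segment_measure0 segment_measure_ge0 segment_measure_sigma_additive.

End segment_measure_is_measure.

Definition triangle_boundary_measure {R : realType} (A B C : R * R) :
    {measure set (plane R) -> \bar R} :=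
  measure_add (measure_add (segment_measure A B) (segment_measure B C))
    (segment_measure C A).

Definition lambda {R : realType} (S alpha a c : R) : \bar R :=
  let A : R * R := (- c, 0) in
  let B : R * R := (c, 0) in
  let C : R * R := (a, S / c) in
  robin_eigenvalue (triangle A B C) (triangle_boundary_measure A B C) alpha.

Definition lambda_equilateral {R : realType} (S alpha : R) : \bar R :=
  lambda S alpha 0 (Num.sqrt (S / Num.sqrt 3)).

(* Main.v *)
Require Import Defs.
From HB Require Import structures.
From mathcomp Require Import all_boot all_order all_algebra.
From mathcomp Require Import all_classical all_reals all_analysis.
From mathcomp Require Import measurable_realfun ring lra.

Set Implicit Arguments.
Unset Strict Implicit.
Unset Printing Implicit Defensive.

Import Order.TTheory GRing.Theory Num.Theory numFieldNormedType.Exports.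

Local Open Scope classical_set_scope.
Local Open Scope ring_scope.

(** The constant function 1 is a competitor for the infimum defining
[lambda S alpha a c], and its Rayleigh quotient is [alpha * P / S], with [P]
the perimeter of the triangle ([robin_eigenvalue_le]).  As [alpha < 0], this
tends to minus infinity as the perimeter grows; and the perimeter is at least
[|a|] (one lateral side is longer), at least [2c] (the base) and at least
[S / c] (the height), so it is large in each of the three regimes.

The other half is that the eigenvalue of the fixed equilateral triangle is not
minus infinity ([robin_eigenvalue_ge]).  This needs a trace inequality
bounding [int_(boundary) v^2] by [K int v^2 + eps int |grad v|^2] with [eps] as
small as desired, so that the negative boundary term is absorbed by the
gradient.  It holds on every isosceles triangle with base on the x-axis and
apex [(0, h)] and comes from the divergence theorem applied to the field
[v^2 (x, y - h/2)].  This field is chosen because its flux density relative to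
[v^2] is a positive constant on each side: on the base the outer normal is
[(0, -1)] and the density is [h/2]; on a lateral side the position vector has
constant normal component, and so has the vertical shift by [h/2].  The
divergence is estimated by Young's inequality ([trace_inequality]).

The divergence theorem on the triangle is obtained by hand
([isosceles_flux]): the x-derivative is integrated along rows and the
y-derivative along columns, using Fubini and the fundamental theorem of
calculus, and the boundary terms are brought to the parametrization of the
sides over the unit interval by affine substitutions.  The inequality then
passes from smooth functions to any [u] in [H^1] and its trace: replacing [u]
by the n-th approximating function changes each integral by a factor of at
most 2 and an additive error that tends to 0 ([trace_bound]). *)

(** * Continuity and measurability in the plane *)
Lemma continuousM_fun (T : topologicalType) (R : realType) (f g : T -> R) :
  continuous f -> continuous g -> continuous (fun t => f t * g t).
Proof. by move=> cf cg t; apply: cvgM; [exact: cf|exact: cg]. Qed.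

Lemma continuousD_fun (T : topologicalType) (R : realType) (f g : T -> R) :
  continuous f -> continuous g -> continuous (fun t => f t + g t).
Proof. by move=> cf cg t; apply: cvgD; [exact: cf|exact: cg]. Qed.

Lemma continuous_along (R : realType) (V : R * R -> R) (f g : R -> R) :
  continuous V -> continuous f -> continuous g ->
  continuous (fun t => V (f t, g t)).
Proof.
move=> cV cf cg t.
apply: (@continuous_comp _ _ _ (fun t : R => (f t, g t)) V t); last exact: cV.
exact: (cvg_pair (cf t) (cg t)).
Qed.

Lemma continuous_affine (R : realType) (u v : R) :
  continuous (fun t : R => u + t * v).
Proof.
by move=> t; apply: cvgD; [exact: cvg_cst|];
  apply: cvgM; [exact: cvg_id|exact: cvg_cst].
Qed.

Lemma continuous_row (R : realType) (f : R * R -> R) (y : R) :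
  continuous f -> continuous (fun x => f (x, y)).
Proof.
move=> cf; apply: continuous_along => //; last exact: cst_continuous.
by move=> x; exact: cvg_id.
Qed.

Lemma continuous_col (R : realType) (f : R * R -> R) (x : R) :
  continuous f -> continuous (fun y => f (x, y)).
Proof.
move=> cf; apply: continuous_along => //; first exact: cst_continuous.
by move=> y; exact: cvg_id.
Qed.

(** The product sigma-algebra contains the open sets because the plane is second
countable: an open set is the union of the squares with rational centre and
rational half-side that it contains. *)
Lemma measurable_open_plane (R : realType) (U : set (R * R)) :
  open U -> measurable (U : set (plane R)).
Proof.
move=> Uopen.
pose box (a b r : rat) : set (plane R) :=
  ball (ratr a : R) (ratr r) `*` ball (ratr b : R) (ratr r).
pose F (a b r : rat) : set (plane R) :=
  [set p | box a b r p /\ box a b r `<=` U].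
have mF a b r : measurable (F a b r).
  have [sub|nsub] := pselect (box a b r `<=` U).
    rewrite (_ : F a b r = box a b r).
      by apply: measurableX; apply: measurable_ball.
    by apply/seteqP; split => p; [case|split].
  rewrite (_ : F a b r = set0)//.
  by apply/seteqP; split => p // -[].
rewrite (_ : (U : set (plane R)) = \bigcup_a \bigcup_b \bigcup_r F a b r).
  by do 3 (apply: bigcupT_measurable_rat => ?); exact: mF.
apply/seteqP; split => [p Up|p [a _ [b _ [r _ [pb]]]]]; last exact.
move: (Uopen); rewrite openE => /(_ p Up) /nbhs_ballP[e /= e0 peU].
have /rat_in_itvoo[r] : e / 4 < e / 2 :> R by lra.
rewrite in_itv/= => /andP[r1 r2].
have /rat_in_itvoo[a] : p.1 - ratr r < p.1 + ratr r by lra.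
rewrite in_itv/= => /andP[a1 a2].
have /rat_in_itvoo[b] : p.2 - ratr r < p.2 + ratr r by lra.
rewrite in_itv/= => /andP[b1 b2].
exists a => //; exists b => //; exists r => //; split.
  by split; rewrite /ball/= ltr_norml; apply/andP; split; lra.
move=> q [/= q1 q2]; apply: peU.
move: q1 q2; rewrite /ball/= !ltr_norml => /andP[? ?] /andP[? ?].
by split; rewrite /ball/= ltr_norml; apply/andP; split; lra.
Qed.

Lemma measurable_fun_plane (R : realType) (f : R * R -> R) :
  continuous f -> measurable_fun setT (f : plane R -> R).
Proof.
move=> /continuousP cf; apply: (measurability _ (RGenOpens.measurableE R)).
move=> _ [_ [a [b ->] <-]]; rewrite setTI; apply: measurable_open_plane.
exact/cf/interval_open.
Qed.

(** * Integrals over rows and columns *)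
Definition bounded_plane (R : realType) (Omega : set (R * R)) : Prop :=
  exists M : R, Omega `<=` `[- M, M] `*` `[- M, M].

Lemma integrable_plane (R : realType) (Omega : set (R * R)) (f : R * R -> R) :
  measurable (Omega : set (plane R)) -> bounded_plane Omega -> continuous f ->
  area.-integrable Omega (EFin \o f).
Proof.
move=> mO [M OM] cf; set box := `[- M, M] `*` `[- M, M] in OM.
have mbox : measurable (box : set (plane R)) by exact: measurableX.
apply: (@measurable_bounded_integrable _ (plane R) R area f Omega mO).
- apply: (@le_lt_trans _ _ (area (box : set (plane R)))).
    by apply: le_measure; rewrite ?inE.
  rewrite (_ : area _ = (lebesgue_measure `[(- M)%R, M]%classic
    * lebesgue_measure `[(- M)%R, M]%classic)%E); last exact: product_measure1E.
  rewrite !lebesgue_measure_itv/=.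
  by case: ifP => _; rewrite ?mule0 ?ltry// -!EFinD -EFinM ltry.
- by apply: measurable_funTS; exact: measurable_fun_plane.
have cbox : compact box by apply: compact_setX; exact: segment_compact.
have fbox := continuous_compact (continuous_subspaceT cf) cbox.
have [N [_ NP]] := compact_bounded fbox.
exists N; split; rewrite ?num_real// => x Nx p Op; apply: NP => //.
by exists p => //; exact: OM.
Qed.

Lemma integral_rows (R : realType) (Omega : set (R * R)) (f : R * R -> R) :
  measurable (Omega : set (plane R)) -> area.-integrable Omega (EFin \o f) ->
  (\int[area]_(p in Omega) (f p)%:E =
   \int[lebesgue_measure]_y \int[lebesgue_measure]_(x in [set x | Omega (x, y)])
     (f (x, y))%:E)%E.
Proof.
move=> mO fO; rewrite integral_mkcond /area -integral21_prod_meas1.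
  apply: eq_integral => y _; rewrite /fubini_G [RHS]integral_mkcond.
  by apply: eq_integral => x _; rewrite /patch /=;
    congr (if _ then _ else _); apply/idP/idP; rewrite !inE.
by rewrite -/area; apply/(integrable_mkcond _ mO).
Qed.

Lemma integral_cols (R : realType) (Omega : set (R * R)) (f : R * R -> R) :
  measurable (Omega : set (plane R)) -> area.-integrable Omega (EFin \o f) ->
  (\int[area]_(p in Omega) (f p)%:E =
   \int[lebesgue_measure]_x \int[lebesgue_measure]_(y in [set y | Omega (x, y)])
     (f (x, y))%:E)%E.
Proof.
move=> mO fO; rewrite integral_mkcond /area -integral12_prod_meas1.
  apply: eq_integral => x _; rewrite /fubini_F [RHS]integral_mkcond.
  by apply: eq_integral => y _; rewrite /patch /=;
    congr (if _ then _ else _); apply/idP/idP; rewrite !inE.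
by rewrite -/area; apply/(integrable_mkcond _ mO).
Qed.

Lemma integral_derivative (R : realType) (f f' : R -> R) (a b : R) :
  a <= b -> continuous f' -> (forall x : R, is_derive x 1 f (f' x)) ->
  (\int[lebesgue_measure]_(x in `]a, b[) (f' x)%:E = (f b - f a)%:E)%E.
Proof.
move=> ab cf' df; have cf : continuous f.
  by move=> x; apply: differentiable_continuous; apply/derivable1_diffP.
move: ab; rewrite le_eqVlt => /predU1P[->|ab].
  by rewrite set_itv_ge ?bnd_simp ?ltxx// integral_set0 subrr.
rewrite integral_itv_obnd_cbnd; last first.
  apply/measurable_EFinP/measurable_funTS.
  exact: continuous_measurable_fun.
rewrite integral_itv_bndo_bndc; last first.
  apply/measurable_EFinP/measurable_funTS.
  exact: continuous_measurable_fun.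
rewrite (@continuous_FTC2 _ f' f)//.
- exact: continuous_subspaceT.
- split => [x _||]; first exact: ex_derive.
    by apply: cvg_at_right_filter; exact: cf.
  by apply: cvg_at_left_filter; exact: cf.
- by move=> x _; rewrite derive1E; exact: derive_val.
Qed.

(** One half of the divergence theorem, for a horizontal field: Fubini along
rows, then the fundamental theorem of calculus on each of them.  The partial
derivative is given through one-variable functions so that products can be
differentiated without differentiability in two variables. *)
Lemma divergence_rows (R : realType) (Omega : set (R * R)) (f f' : R * R -> R)
    (a b : R) (l r : R -> R) :
  measurable (Omega : set (plane R)) -> bounded_plane Omega -> continuous f' ->
  (forall x y : R, is_derive x 1 (fun t => f (t, y)) (f' (x, y))) ->
  (forall x y, Omega (x, y) <-> a < y < b /\ l y < x < r y) ->
  (forall y, a < y < b -> l y <= r y) ->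
  (\int[area]_(p in Omega) (f' p)%:E =
   \int[lebesgue_measure]_(y in `]a, b[) (f (r y, y) - f (l y, y))%:E)%E.
Proof.
move=> mO bO cf' df OE lr.
rewrite integral_rows//; last exact: integrable_plane.
rewrite [RHS]integral_mkcond; apply: eq_integral => y _.
rewrite /patch; case: ifPn => [|]; rewrite ?inE ?notin_setE /= in_itv/= => aby.
  rewrite (_ : [set x | _] = `]l y, r y[%classic).
    rewrite (integral_derivative (f := fun x => f (x, y)))//; first exact: lr.
    exact: continuous_row.
  by apply/seteqP; split => x /=; rewrite in_itv/= OE; [case|].
rewrite (_ : [set x | _] = set0) ?integral_set0//.
by apply/seteqP; split => x //=; rewrite OE => -[].
Qed.

Lemma divergence_cols (R : realType) (Omega : set (R * R)) (f f' : R * R -> R)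
    (a b : R) (l r : R -> R) :
  measurable (Omega : set (plane R)) -> bounded_plane Omega -> continuous f' ->
  (forall x y : R, is_derive y 1 (fun t => f (x, t)) (f' (x, y))) ->
  (forall x y, Omega (x, y) <-> a < x < b /\ l x < y < r x) ->
  (forall x, a < x < b -> l x <= r x) ->
  (\int[area]_(p in Omega) (f' p)%:E =
   \int[lebesgue_measure]_(x in `]a, b[) (f (x, r x) - f (x, l x))%:E)%E.
Proof.
move=> mO bO cf' df OE lr.
rewrite integral_cols//; last exact: integrable_plane.
rewrite [RHS]integral_mkcond; apply: eq_integral => x _.
rewrite /patch; case: ifPn => [|]; rewrite ?inE ?notin_setE /= in_itv/= => abx.
  rewrite (_ : [set y | _] = `]l x, r x[%classic).
    rewrite (integral_derivative (f := fun y => f (x, y)))//; first exact: lr.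
    exact: continuous_col.
  by apply/seteqP; split => y /=; rewrite in_itv/= OE; [case|].
rewrite (_ : [set y | _] = set0) ?integral_set0//.
by apply/seteqP; split => y //=; rewrite OE => -[].
Qed.

Lemma integrable_continuous_itv (R : realType) (f : R -> R) (a b : R) :
  continuous f ->
  (@lebesgue_measure R).-integrable `[a, b]%classic (EFin \o f).
Proof.
move=> cf; apply: continuous_compact_integrable; first exact: segment_compact.
exact: continuous_subspaceT.
Qed.

(** The interval is open on the left-hand side because Fubini produces open
slices, and closed on the right-hand side to match arc length on a segment. *)
Lemma integral_itv_affine (R : realType) (f : R -> R) (a b : R) :
  a < b -> continuous f ->
  (\int[lebesgue_measure]_(x in `]a, b[) (f x)%:E =
   ((b - a) * \int[lebesgue_measure]_(t in `[0, 1]) f (a + t * (b - a)))%:E)%E.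
Proof.
move=> ab cf; have mf D : measurable_fun D (EFin \o f).
  apply/measurable_EFinP/measurable_funTS.
  exact: continuous_measurable_fun.
rewrite integral_itv_obnd_cbnd// integral_itv_bndo_bndc//.
pose F (t : R) : R := a + t * (b - a).
have dF (t : R) : is_derive t 1 F (b - a).
  rewrite /F; apply: is_derive_eq.
  by rewrite add0r mul1r scaler0 add0r; exact: mulr1.
have cF : continuous F.
  by move=> t; apply: differentiable_continuous; apply/derivable1_diffP;
  exact: ex_derive.
have DF : derive1 F = cst (b - a).
  by apply/funext => t; rewrite derive1E derive_val.
have F0 : F 0 = a by rewrite /F mul0r addr0.
have F1 : F 1 = b by rewrite /F mul1r subrKC.
have -> : `[a, b]%classic = `[F 0, F 1]%classic :> set R by rewrite F0 F1.
rewrite integration_by_substitution_increasing ?DF//.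
- rewrite -RintegralZl//; last first.
    by apply: (@integrable_continuous_itv R (f \o F)) => t;
      exact: continuous_comp (cF t) (cf _).
  rewrite /Rintegral fineK; last first.
    apply: integrable_fin_num => //.
    apply: (@integrable_continuous_itv R (fun x => (b - a) * (f \o F) x)) => t.
    apply: cvgM; first exact: cvg_cst.
    exact: continuous_comp (cF t) (cf _).
  by apply: eq_integral => t _ /=; rewrite mulrC.
- by move=> s t _ _ st; rewrite /F; nra.
- by move=> t _; exact: cvg_cst.
- exact: is_cvg_cst.
- exact: is_cvg_cst.
- split; [by move=> t _; exact: ex_derive| |].
    by apply: cvg_at_right_filter; exact: cF.
  by apply: cvg_at_left_filter; exact: cF.
- exact: continuous_subspaceT.
Qed.

Lemma Rintegral_unit_onem (R : realType) (f : R -> R) : continuous f ->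
  \int[lebesgue_measure]_(t in `[0, 1]) f (1 - t) =
  \int[lebesgue_measure]_(t in `[0, 1]) f t.
Proof.
move=> cf; rewrite [RHS]Rintegration_by_substitution_onem ?ler01 ?lexx//.
  by rewrite unstable.onem1.
exact: continuous_subspaceT.
Qed.

(** * Arc length integrals on the sides of a triangle *)
Lemma ge0_integral_mrestr d (T : measurableType d) (R : realType)
    (mu : {measure set T -> \bar R}) (D : set T) (mD : measurable D)
    (f : T -> \bar R) :
  measurable_fun setT f -> (forall x, 0 <= f x)%E ->
  (\int[mrestr mu mD]_x f x = \int[mu]_(x in D) f x)%E.
Proof.
move=> mf f0.
rewrite [LHS](ge0_negligible_integral (measurableC mD))//; last first.
  by rewrite -[LHS]/(mu (~` D `&` D)) setICl measure0.
rewrite setTD setCK.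
by apply: eq_measure_integral => A mA AD; rewrite -[LHS]/(mu (A `&` D)) setIidl.
Qed.

Lemma ge0_integral_segment (R : realType) (A B : R * R) (g : R * R -> R) :
  measurable_fun setT (g : plane R -> R) -> (forall p, 0 <= g p) ->
  (\int[segment_measure A B]_p (g p)%:E =
   (segment_length A B)%:E *
     \int[lebesgue_measure]_(t in `[0%R, 1%R]) (g (segment_path A B t))%:E)%E.
Proof.
move=> mg g0; have mpath := measurable_segment_path A B.
have mgp : measurable_fun setT (fun t => (g (segment_path A B t))%:E).
  by apply/measurable_EFinP; exact: measurableT_comp mpath.
rewrite /segment_measure ge0_integral_pushforward//; last 2 first.
- exact/measurable_EFinP.
- by move=> p _; rewrite lee_fin.
rewrite preimage_setT ge0_integral_mscale//=; last first.
  by move=> t _; rewrite lee_fin.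
by rewrite ge0_integral_mrestr// => t; rewrite lee_fin.
Qed.

Lemma integral_segment (R : realType) (A B : R * R) (g : R * R -> R) :
  continuous g -> (forall p, 0 <= g p) ->
  (\int[segment_measure A B]_p (g p)%:E =
   (segment_length A B *
     \int[lebesgue_measure]_(t in `[0, 1]) g (segment_path A B t))%:E)%E.
Proof.
move=> cg g0; rewrite ge0_integral_segment//; last exact: measurable_fun_plane.
rewrite EFinM /Rintegral fineK//; apply: integrable_fin_num => //.
have cgp : continuous (fun t : R => g (segment_path A B t)).
  by apply: continuous_along => //; exact: continuous_affine.
exact: (integrable_continuous_itv 0 1 cgp).
Qed.

Lemma integral_triangle_boundary (R : realType) (A B C : R * R)
    (g : R * R -> R) :
  measurable_fun setT (g : plane R -> R) -> (forall p, 0 <= g p) ->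
  (\int[triangle_boundary_measure A B C]_p (g p)%:E =
   \int[segment_measure A B]_p (g p)%:E + \int[segment_measure B C]_p (g p)%:E
   + \int[segment_measure C A]_p (g p)%:E)%E.
Proof.
move=> mg g0; have g0' p : setT p -> (0 <= (g p)%:E)%E by rewrite lee_fin.
have mg' : measurable_fun setT (EFin \o (g : plane R -> R)).
  exact/measurable_EFinP.
rewrite /triangle_boundary_measure ge0_integral_measure_add//.
by rewrite ge0_integral_measure_add.
Qed.

(** * The triangle as a region between graphs *)
(** The barycentric coordinate of the apex is [y / h], and the other two are
proportional to the horizontal distances to the lateral sides; hence the
row at height [y] is an interval. *)
Lemma triangle_rows (R : realType) (a c h x y : R) : 0 < c -> 0 < h ->
  triangle (- c, 0) (c, 0) (a, h) (x, y) <->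
  0 < y < h /\ - c + (a + c) * (y / h) < x < c + (a - c) * (y / h).
Proof.
move=> c0 h0; split.
  move=> [s [t [r [s0 t0 r0 str1 /= [-> ->]]]]].
  have -> : (s * 0 + t * 0 + r * h) / h = r by field; rewrite gt_eqF.
  split; apply/andP; split; nra.
move=> [/andP[y0 yh] /andP[lx xr]].
exists ((c + (a - c) * (y / h) - x) / (2 * c)).
exists ((x - (- c + (a + c) * (y / h))) / (2 * c)); exists (y / h).
split; [by apply: divr_gt0; lra|by apply: divr_gt0; lra|exact: divr_gt0|..].
  by field; rewrite !gt_eqF.
by congr pair => /=; field; rewrite !gt_eqF.
Qed.

(** Columns are only described for an apex above the midpoint of the base, where
the upper boundary is the graph of a single formula in [|x|]. *)
Lemma isosceles_cols (R : realType) (c h x y : R) : 0 < c -> 0 < h ->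
  triangle (- c, 0) (c, 0) (0, h) (x, y) <->
  - c < x < c /\ 0 < y < h * (1 - `|x| / c).
Proof.
move=> c0 h0; rewrite triangle_rows//.
have yE : (y < h * (1 - `|x| / c)) = (`|x| < c * (1 - y / h)).
  have -> : h * (1 - `|x| / c) = h / c * (c - `|x|) by field; rewrite gt_eqF.
  have -> : c * (1 - y / h) = c - y * (c / h) by field; rewrite gt_eqF.
  rewrite mulrC -ltr_pdivrMr ?divr_gt0// invf_div.
  by apply/idP/idP; lra.
rewrite yE ltr_norml.
split.
  move=> [/andP[y0 yh] /andP[lx xr]].
  have : 0 < y / h by exact: divr_gt0.
  by move=> yh0; split; apply/andP; split=> //; try (apply/andP; split); nra.
move=> [/andP[cx xc] /andP[y0 /andP[lx xr]]].
have yh1 : y / h < 1 by nra.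
by move: (yh1); rewrite ltr_pdivrMr// mul1r => yh;
  split; apply/andP; split=> //; nra.
Qed.

Lemma measurable_gt0_plane (R : realType) (f : R * R -> R) :
  continuous f -> measurable ([set p | 0 < f p] : set (plane R)).
Proof.
move=> /measurable_fun_plane mf; rewrite -[X in measurable X]setTI.
rewrite (_ : [set p | _] = f @^-1` `]0, +oo[%classic); first exact: mf.
by apply/seteqP; split => p /=; rewrite in_itv/= andbT.
Qed.

Lemma continuous_affine_plane (R : realType) (u v w : R) :
  continuous (fun p : R * R => u + v * p.1 + w * p.2).
Proof.
move=> p; apply: cvgD; [apply: cvgD; [exact: cvg_cst|]|]; apply: cvgM;
  [exact: cvg_cst|exact: cvg_fst|exact: cvg_cst|exact: cvg_snd].
Qed.

Lemma measurable_triangle (R : realType) (a c h : R) : 0 < c -> 0 < h ->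
  measurable (triangle (- c, 0) (c, 0) (a, h) : set (plane R)).
Proof.
move=> c0 h0.
pose f u v w (p : R * R) : R := u + v * p.1 + w * p.2.
rewrite (_ : triangle _ _ _ =
    [set p | 0 < f 0 0 1 p] `&` [set p | 0 < f h 0 (- 1) p] `&`
    [set p | 0 < f c 1 (- (a + c) / h) p] `&`
    [set p | 0 < f c (- 1) ((a - c) / h) p]).
  apply: measurableI; [apply: measurableI; [apply: measurableI|]|];
    apply: measurable_gt0_plane;
    exact: continuous_affine_plane.
apply/seteqP; split => -[x y] /=; rewrite triangle_rows// /f/=.
  by move=> [/andP[? ?] /andP[? ?]]; split; [split; [split|]|]; lra.
by move=> [[[? ?] ?] ?]; split; apply/andP; split; lra.
Qed.

Lemma bounded_triangle (R : realType) (a c h : R) : 0 < c -> 0 < h ->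
  bounded_plane (triangle (- c, 0) (c, 0) (a, h)).
Proof.
move=> c0 h0; exists (c + `|a| + h) => -[x y]; rewrite triangle_rows//.
move=> [/andP[y0 yh] /andP[lx xr]].
have a1 := ler_norm a; have a2 := ler_norm (- a); rewrite normrN in a2.
have : 0 < y / h by exact: divr_gt0.
have : y / h < 1 by rewrite ltr_pdivrMr// mul1r.
by move=> yh1 yh0; split; rewrite /= in_itv/=; apply/andP; split; nra.
Qed.

(** The field [(x, 0)] has divergence 1, so the row lemma computes the area. *)
Lemma area_triangle (R : realType) (a c h : R) : 0 < c -> 0 < h ->
  area (triangle (- c, 0) (c, 0) (a, h)) = (c * h)%:E.
Proof.
move=> c0 h0; have mT := measurable_triangle a c0 h0.
have := integral_cst area mT 1; rewrite mul1e => <-.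
rewrite (@divergence_rows _ _ fst (cst 1) 0 h
  (fun y => - c + (a + c) * (y / h)) (fun y => c + (a - c) * (y / h)))//.
- rewrite (_ : c * h = 2 * c * (h - h ^+ 2 / (2 * h)) -
                       2 * c * (0 - 0 ^+ 2 / (2 * h))); last first.
    by field; rewrite gt_eqF.
  have cF : continuous (fun y : R => 2 * c * (1 - y / h)).
    move=> y; apply: cvgM; first exact: cvg_cst.
    apply: cvgB; first exact: cvg_cst.
    by apply: cvgM; [exact: cvg_id|exact: cvg_cst].
  have dF (y : R) : is_derive y 1 (fun y : R => 2 * c * (y - y ^+ 2 / (2 * h)))
      (2 * c * (1 - y / h)).
    apply: is_derive_eq; rewrite /GRing.scale/=.
    by field; rewrite gt_eqF.
  apply: etrans (integral_derivative (ltW h0) cF dF).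
  by apply: eq_integral => y _; congr EFin => /=; field; rewrite gt_eqF.
- exact: bounded_triangle.
- exact: cst_continuous.
- by move=> x y; exact: triangle_rows.
- move=> y /andP[y0 yh].
  have : y / h < 1 by rewrite ltr_pdivrMr// mul1r.
  by nra.
Qed.

(** * Flux through the boundary of an isosceles triangle *)
(** Directional derivatives in the plane are turned into ordinary derivatives of
the restriction to a line, for use in the divergence lemmas. *)
Lemma is_derive_row (R : realType) (v : R * R -> R) (x y : R) :
  derivable v (x, y) (1, 0) ->
  is_derive x 1 (fun t => v (t, y)) ('D_(1, 0) v (x, y)).
Proof.
have E : (fun k : R => k^-1 *: (v (k *: (1, 0) + (x, y)) - v (x, y))) =
    (fun k : R => k^-1 *: (v (k *: 1 + x, y) - v (x, y))).
  apply/funext => k; congr (_ *: (v _ - _)).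
  by congr pair => /=; rewrite scaler0 add0r.
by move=> dv; split; rewrite /derivable /derive -E.
Qed.

Lemma is_derive_col (R : realType) (v : R * R -> R) (x y : R) :
  derivable v (x, y) (0, 1) ->
  is_derive y 1 (fun t => v (x, t)) ('D_(0, 1) v (x, y)).
Proof.
have E : (fun k : R => k^-1 *: (v (k *: (0, 1) + (x, y)) - v (x, y))) =
    (fun k : R => k^-1 *: (v (x, k *: 1 + y) - v (x, y))).
  apply/funext => k; congr (_ *: (v _ - _)).
  by congr pair => /=; rewrite scaler0 add0r.
by move=> dv; split; rewrite /derivable /derive -E.
Qed.

Lemma integrable_continuous_oo (R : realType) (f : R -> R) (a b : R) :
  continuous f ->
  (@lebesgue_measure R).-integrable `]a, b[%classic (EFin \o f).
Proof.
move=> cf; apply: integrableS (integrable_continuous_itv a b cf) => //.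
exact: subset_itv_oo_cc.
Qed.

Lemma integral_itv_split (R : realType) (f : R -> R) (a m b : R) :
  a < m -> m < b -> continuous f ->
  (\int[lebesgue_measure]_(x in `]a, b[) (f x)%:E =
   \int[lebesgue_measure]_(x in `]a, m[) (f x)%:E +
   \int[lebesgue_measure]_(x in `]m, b[) (f x)%:E)%E.
Proof.
move=> am mb cf.
rewrite (@itv_bndbnd_setU _ _ (BRight a) (BRight m)) ?bnd_simp ?ltW//.
have mf D : measurable_fun D (EFin \o f).
  apply/measurable_EFinP/measurable_funTS.
  exact: continuous_measurable_fun.
rewrite integral_setU//=; last 2 first.
- exact: mf.
- apply/disj_setPS => x [/=]; rewrite !in_itv/= => /andP[_ xm] /andP[mx _].
  by move: (lt_le_trans mx xm); rewrite ltxx.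
by rewrite [in RHS]integral_itv_bndo_bndc.
Qed.

Section unit_integral.
Context {R : realType}.
Implicit Types f g : R -> R.

Lemma Rintegral_unitD f g : continuous f -> continuous g ->
  \int[lebesgue_measure]_(t in `[0, 1]) (f t + g t) =
  \int[lebesgue_measure]_(t in `[0, 1]) f t +
  \int[lebesgue_measure]_(t in `[0, 1]) g t.
Proof.
by move=> cf cg; rewrite RintegralD//; exact: integrable_continuous_itv.
Qed.

Lemma Rintegral_unitZ (k : R) f : continuous f ->
  \int[lebesgue_measure]_(t in `[0, 1]) (k * f t) =
  k * \int[lebesgue_measure]_(t in `[0, 1]) f t.
Proof.
by move=> cf; rewrite RintegralZl//; exact: integrable_continuous_itv.
Qed.

End unit_integral.

Lemma Rintegral_unit_weight (R : realType) (u v : R) (f : R -> R) :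
  continuous f ->
  \int[lebesgue_measure]_(t in `[0, 1]) ((u + t * v) * f t) =
  u * \int[lebesgue_measure]_(t in `[0, 1]) f t +
  v * \int[lebesgue_measure]_(t in `[0, 1]) (t * f t).
Proof.
move=> cf; have ctf : continuous (fun t : R => t * f t).
  by apply: continuousM_fun => // t; exact: cvg_id.
rewrite -Rintegral_unitZ// -Rintegral_unitZ// -Rintegral_unitD.
- by apply: eq_Rintegral => t _; ring.
- by apply: continuousM_fun => // t; exact: cvg_cst.
- by apply: continuousM_fun => // t; exact: cvg_cst.
Qed.

(** The divergence theorem for the field [V (x, y - h/2)].  The weight of the
lateral sides is half that of the base: with [t] the relative height on a
lateral side, the x-component contributes [c h (1 - t)] and the y-component
[c h (t - 1/2)], and these add up to the constant [c h / 2]. *)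
Lemma isosceles_flux (R : realType) (c h : R) (V Vx Vy : R * R -> R) :
  0 < c -> 0 < h -> continuous V -> continuous Vx -> continuous Vy ->
  (forall x y : R, is_derive x 1 (fun t => V (t, y)) (Vx (x, y))) ->
  (forall x y : R, is_derive y 1 (fun t => V (x, t)) (Vy (x, y))) ->
  let A := (- c, 0) in let B := (c, 0) in let C := (0, h) in
  (\int[area]_(p in triangle A B C)
      (V p + p.1 * Vx p + (V p + (p.2 - h / 2) * Vy p))%:E =
   (c * h * \int[lebesgue_measure]_(t in `[0, 1]) V (segment_path A B t) +
    c * h / 2 * \int[lebesgue_measure]_(t in `[0, 1]) V (segment_path B C t) +
    c * h / 2 * \int[lebesgue_measure]_(t in `[0, 1]) V (segment_path C A t))%:E
  )%E.
Proof.
move=> c0 h0 cV cVx cVy dx dy A B C.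
have mT := measurable_triangle 0 c0 h0.
have bT := bounded_triangle 0 c0 h0.
pose L t := V (- c + t * c, t * h).
pose Rt t := V (c - t * c, t * h).
pose Bt t := V (- c + t * (c - - c), 0).
have cid0 (k : R) : continuous (fun t : R => t * k).
  by move=> t; apply: cvgM; [exact: cvg_id|exact: cvg_cst].
have cL : continuous L.
  by apply: continuous_along => //; exact: continuous_affine.
have cR : continuous Rt.
  apply: continuous_along => // t.
  by apply: cvgB; [exact: cvg_cst|exact: cid0].
have cB : continuous Bt.
  apply: continuous_along => //; first exact: continuous_affine.
  exact: cst_continuous.
have cy : continuous (fun p : R * R => p.2 - h / 2).
  by move=> p; apply: cvgB; [exact: cvg_snd|exact: cvg_cst].
rewrite (_ : \int[lebesgue_measure]_(t in `[0, 1]) V (segment_path A B t) =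
  \int[lebesgue_measure]_(t in `[0, 1]) Bt t); last first.
  apply: eq_Rintegral => t _; rewrite /segment_path /A /B /Bt/=.
  by congr (V (_, _)); ring.
rewrite (_ : \int[lebesgue_measure]_(t in `[0, 1]) V (segment_path B C t) =
  \int[lebesgue_measure]_(t in `[0, 1]) Rt t); last first.
  apply: eq_Rintegral => t _; rewrite /segment_path /A /B /C /Rt/=.
  by congr (V (_, _)); ring.
rewrite (_ : \int[lebesgue_measure]_(t in `[0, 1]) V (segment_path C A t) =
  \int[lebesgue_measure]_(t in `[0, 1]) L t); last first.
  rewrite -[RHS]Rintegral_unit_onem//.
  apply: eq_Rintegral => t _; rewrite /segment_path /A /B /C /L/=.
  by congr (V (_, _)); ring.
pose fx (p : R * R) := V p + p.1 * Vx p.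
pose fy (p : R * R) := V p + (p.2 - h / 2) * Vy p.
have cfx : continuous fx.
  apply: continuousD_fun => //.
  by apply: continuousM_fun => // p; exact: cvg_fst.
have cfy : continuous fy.
  by apply: continuousD_fun => //; exact: continuousM_fun.
have dfx (x y : R) : is_derive x 1 (fun t : R => t * V (t, y)) (fx (x, y)).
  by apply: is_derive_eq; rewrite /fx /GRing.scale/=; ring.
have dfy (x y : R) : is_derive y 1 (fun t : R => (t - h / 2) * V (x, t))
    (fy (x, y)).
  by apply: is_derive_eq; rewrite /fy /GRing.scale/=; ring.
have ifx : area.-integrable (triangle A B C) (EFin \o fx).
  exact: integrable_plane.
have ify : area.-integrable (triangle A B C) (EFin \o fy).
  exact: integrable_plane.
transitivity (\int[area]_(p in triangle A B C) (fx p)%:E +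
    \int[area]_(p in triangle A B C) (fy p)%:E)%E; first by rewrite -integralD.
(* Rows give the x-component: only the lateral sides contribute. *)
have X : (\int[area]_(p in triangle A B C) (fx p)%:E =
    (h * \int[lebesgue_measure]_(t in `[0, 1])
      (c * (1 - t) * (L t + Rt t)))%:E)%E.
  rewrite (divergence_rows (f := fun p => p.1 * V p) (a := 0) (b := h)
    (l := fun y => - c + y * (c / h)) (r := fun y => c - y * (c / h))
    mT bT cfx dfx); last 2 first.
  - move=> x y; rewrite triangle_rows// sub0r add0r.
    by rewrite mulNr (mulrC c) mulrAC -mulrA.
  - move=> y /andP[y0 yh].
    have : y / h < 1 by rewrite ltr_pdivrMr// mul1r.
    by rewrite mulrCA; nra.
  rewrite integral_itv_affine//; last first.
    have cl : continuous (fun y : R => - c + y * (c / h)).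
      exact: continuous_affine.
    have cr : continuous (fun y : R => c - y * (c / h)).
      by move=> t; apply: cvgB; [exact: cvg_cst|exact: cid0].
    have cid : continuous (fun y : R => y) by move=> y; exact: cvg_id.
    move=> y /=; apply: cvgB; apply: cvgM.
    - exact: cr.
    - exact: (continuous_along cV cr cid).
    - exact: cl.
    - exact: (continuous_along cV cl cid).
  rewrite subr0; congr (_ * _)%:E; apply: eq_Rintegral => t _ /=.
  rewrite add0r /L /Rt.
  have -> : t * h * (c / h) = t * c by field; rewrite gt_eqF.
  ring.
(* Columns give the y-component: the base and, at the other end of each column,
   the two lateral sides, separated at the apex. *)
have Y : (\int[area]_(p in triangle A B C) (fy p)%:E =
    ((c * h) * \int[lebesgue_measure]_(t in `[0, 1]) Bt t +
     c * \int[lebesgue_measure]_(t in `[0, 1]) ((t * h - h / 2) * L t) +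
     c * \int[lebesgue_measure]_(t in `[0, 1]) ((t * h - h / 2) * Rt t))%:E)%E.
  rewrite (divergence_cols (f := fun p => (p.2 - h / 2) * V p)
    (a := - c) (b := c) (l := fun=> 0) (r := fun x => h * (1 - `|x| / c))
    mT bT cfy dfy); last 2 first.
  - by move=> x y; exact: isosceles_cols.
  - move=> x /andP[cx xc]; apply: mulr_ge0; first exact: ltW.
    by rewrite subr_ge0 ler_pdivrMr// mul1r ler_norml !ltW.
  pose top (x : R) := h * (1 - `|x| / c).
  have ctop : continuous top.
    move=> x; apply: cvgM; first exact: cvg_cst.
    apply: cvgB; first exact: cvg_cst.
    by apply: cvgM; [exact: norm_continuous|exact: cvg_cst].
  have cid : continuous (fun y : R => y) by move=> y; exact: cvg_id.
  pose roof x := (top x - h / 2) * V (x, top x).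
  pose base x := h / 2 * V (x, 0).
  have croof : continuous roof.
    apply: continuousM_fun; last exact: continuous_along.
    by move=> x; apply: cvgB; [exact: ctop|exact: cvg_cst].
  have cbase : continuous base.
    apply: continuousM_fun; first by move=> x; exact: cvg_cst.
    by apply: continuous_along => //; exact: cst_continuous.
  transitivity (\int[lebesgue_measure]_(x in `](- c)%R, c[) (roof x)%:E +
      \int[lebesgue_measure]_(x in `](- c)%R, c[) (base x)%:E)%E.
    rewrite -integralD//=; [|exact: integrable_continuous_oo..].
    apply: eq_integral => x _; rewrite -EFinD /roof /base /top /=.
    by congr EFin; ring.
  rewrite (@integral_itv_split _ _ _ 0)//; last by rewrite oppr_lt0.
  rewrite !integral_itv_affine ?oppr_lt0 ?gtrN// -!EFinD; congr EFin.
  rewrite -[RHS]addrA [RHS]addrC; congr (_ + _ + _).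
  - rewrite sub0r opprK; congr (_ * _); apply: eq_Rintegral => t.
    rewrite inE/= in_itv/= => /andP[t0 t1].
    rewrite /roof /L (_ : top _ = t * h)// /top.
    have -> : `|- c + t * c| = c - t * c by rewrite ler0_norm; nra.
    by field; rewrite gt_eqF.
  - rewrite subr0 -[in RHS]Rintegral_unit_onem; last first.
      apply: continuousM_fun => //.
      by move=> t; apply: cvgB; [exact: cid0|exact: cvg_cst].
    congr (_ * _); apply: eq_Rintegral => t.
    rewrite inE/= in_itv/= => /andP[t0 t1].
    have topE : top (0 + t * c) = (1 - t) * h.
      rewrite /top ger0_norm; last nra.
      by field; rewrite gt_eqF.
    rewrite /roof /Rt topE; congr (_ * V (_, _)); ring.
  - rewrite (Rintegral_unitZ (h / 2) cB).
    by field.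
rewrite X Y -EFinD; congr EFin.
have -> : \int[lebesgue_measure]_(t in `[0, 1]) (c * (1 - t) * (L t + Rt t)) =
    \int[lebesgue_measure]_(t in `[0, 1]) ((c + t * - c) * (L t + Rt t)).
  by apply: eq_Rintegral => t _; ring.
have tB (f : R -> R) :
    \int[lebesgue_measure]_(t in `[0, 1]) ((t * h - h / 2) * f t) =
    \int[lebesgue_measure]_(t in `[0, 1]) ((- (h / 2) + t * h) * f t).
  by apply: eq_Rintegral => t _; ring.
have ctM (f : R -> R) : continuous f -> continuous (fun t : R => t * f t).
  by move=> cf; apply: continuousM_fun => // t; exact: cvg_id.
rewrite !tB !Rintegral_unit_weight//; last exact: continuousD_fun.
rewrite Rintegral_unitD//.
have -> : \int[lebesgue_measure]_(t in `[0, 1]) (t * (L t + Rt t)) =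
    \int[lebesgue_measure]_(t in `[0, 1]) (t * L t) +
    \int[lebesgue_measure]_(t in `[0, 1]) (t * Rt t).
  rewrite -Rintegral_unitD; [|exact: ctM..].
  by apply: eq_Rintegral => t _; ring.
by field.
Qed.

(** * The trace inequality *)
(** The field with constant flux bounds the boundary integral by [k] times the
integral of its divergence [2 v^2 + 2 v (x v_x + (y - h/2) v_y)]; Young's
inequality moves an arbitrarily small part of the mixed term to the gradient,
the coordinates being bounded by [c] and [h]. *)
Lemma trace_inequality (R : realType) (c h eps : R) :
  0 < c -> 0 < h -> 0 < eps ->
  let A := (- c, 0) in let B := (c, 0) in let C := (0, h) in
  exists2 K : R, 0 <= K & forall v : R * R -> R, Ck 1 v ->
    (\int[triangle_boundary_measure A B C]_p (v p ^+ 2)%:E <=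
     \int[area]_(p in triangle A B C)
       (K * v p ^+ 2 + eps * ('D_(1, 0) v p ^+ 2 + 'D_(0, 1) v p ^+ 2))%:E)%E.
Proof.
move=> c0 h0 eps0 A B C.
pose l1 := segment_length A B; pose l2 := segment_length B C.
pose l3 := segment_length C A.
have l10 : 0 <= l1 by exact: segment_length_ge0.
have l20 : 0 <= l2 by exact: segment_length_ge0.
have l30 : 0 <= l3 by exact: segment_length_ge0.
(* The sides carry flux weights c h and c h / 2, so this k makes k times the
   flux dominate the arc length integral on each side. *)
pose k := 2 * (l1 + l2 + l3) / (c * h).
have k0 : 0 <= k by apply: divr_ge0; [lra|rewrite mulr_ge0// ltW].
exists (2 * k + k ^+ 2 * (c ^+ 2 + h ^+ 2) / eps).
  apply: addr_ge0; first lra.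
  by apply: divr_ge0 (ltW eps0); rewrite mulr_ge0 ?addr_ge0 ?sqr_ge0.
move=> v [cv dv cv1 cv2].
have mT := measurable_triangle 0 c0 h0.
have bT := bounded_triangle 0 c0 h0.
pose V p := v p ^+ 2.
pose Vx p := 2 * v p * 'D_(1, 0) v p; pose Vy p := 2 * v p * 'D_(0, 1) v p.
have cstc (m : R) : continuous (fun _ : R * R => m) by exact: cst_continuous.
have cV : continuous V := continuousM_fun cv cv.
have c2v := continuousM_fun (cstc 2) cv.
have cVx : continuous Vx := continuousM_fun c2v cv1.
have cVy : continuous Vy := continuousM_fun c2v cv2.
have dVx (x y : R) : is_derive x 1 (fun t : R => V (t, y)) (Vx (x, y)).
  have dvx := is_derive_row (dv (x, y)).1.
  by apply: is_derive_eq; rewrite /Vx /GRing.scale/=; ring.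
have dVy (x y : R) : is_derive y 1 (fun t : R => V (x, t)) (Vy (x, y)).
  have dvy := is_derive_col (dv (x, y)).2.
  by apply: is_derive_eq; rewrite /Vy /GRing.scale/=; ring.
pose F p := V p + p.1 * Vx p + (V p + (p.2 - h / 2) * Vy p).
have cfst : continuous (fun p : R * R => p.1) by move=> p; exact: cvg_fst.
have csnd : continuous (fun p : R * R => p.2 - h / 2).
  by move=> p; apply: cvgB; [exact: cvg_snd|exact: cvg_cst].
have cF : continuous F :=
  continuousD_fun (continuousD_fun cV (continuousM_fun cfst cVx))
                  (continuousD_fun cV (continuousM_fun csnd cVy)).
have iF : area.-integrable (triangle A B C) (EFin \o F).
  exact: integrable_plane.
have V0 p : 0 <= V p by exact: sqr_ge0.
rewrite integral_triangle_boundary//; last exact: measurable_fun_plane.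
rewrite !(@integral_segment _ _ _ V)// -!EFinD -/l1 -/l2 -/l3.
have flux := isosceles_flux c0 h0 cV cVx cVy dVx dVy.
apply: (@le_trans _ _ (k%:E * \int[area]_(p in triangle A B C) (F p)%:E)%E).
  rewrite flux -EFinM lee_fin -/A -/B -/C.
  set I1 := Rintegral _ _ _; set I2 := Rintegral _ _ _.
  set I3 := Rintegral _ _ _.
  have I10 : 0 <= I1 by apply: Rintegral_ge0.
  have I20 : 0 <= I2 by apply: Rintegral_ge0.
  have I30 : 0 <= I3 by apply: Rintegral_ge0.
  have kE : k * (c * h) = 2 * (l1 + l2 + l3).
    by rewrite /k; field; rewrite !gt_eqF.
  have -> : k * (c * h * I1 + c * h / 2 * I2 + c * h / 2 * I3) =
      (k * (c * h)) * (I1 + I2 / 2 + I3 / 2) by field.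
  rewrite kE; nra.
rewrite -integralZl//; apply: le_integral => //.
- exact: integrableZl.
- pose G p := (2 * k + k ^+ 2 * (c ^+ 2 + h ^+ 2) / eps) * V p +
              eps * ('D_(1, 0) v p * 'D_(1, 0) v p +
                     'D_(0, 1) v p * 'D_(0, 1) v p).
  have cG : continuous G := continuousD_fun (continuousM_fun (cstc _) cV)
    (continuousM_fun (cstc eps)
       (continuousD_fun (continuousM_fun cv1 cv1) (continuousM_fun cv2 cv2))).
  exact: (integrable_plane mT bT cG).
move=> [x y]; rewrite inE => Txy.
have [/andP[y0 yh] _] := (triangle_rows 0 x y c0 h0).1 Txy.
have [/andP[cx xc] _] := (isosceles_cols x y c0 h0).1 Txy.
rewrite -EFinM lee_fin /F /V /Vx /Vy /=.
set D1 := 'D_(1, 0) v _; set D2 := 'D_(0, 1) v _; set w := v _.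
have young (z m d : R) : z ^+ 2 <= m ^+ 2 ->
    k * (z * (2 * w * d)) <= k ^+ 2 * m ^+ 2 / eps * w ^+ 2 + eps * d ^+ 2.
  move=> zm; rewrite -subr_ge0.
  have -> : k ^+ 2 * m ^+ 2 / eps * w ^+ 2 + eps * d ^+ 2 -
      k * (z * (2 * w * d)) = (eps * d - k * z * w) ^+ 2 / eps +
      k ^+ 2 * w ^+ 2 * (m ^+ 2 - z ^+ 2) / eps.
    by field; rewrite gt_eqF.
  apply: addr_ge0; apply: divr_ge0 (ltW eps0); first exact: sqr_ge0.
  apply: mulr_ge0; last by rewrite subr_ge0.
  by apply: mulr_ge0; exact: sqr_ge0.
have Yx := young x c D1; have Yy := young (y - h / 2) h D2.
have x2 : x ^+ 2 <= c ^+ 2 by nra.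
have y2 : (y - h / 2) ^+ 2 <= h ^+ 2 by nra.
move: {Yx Yy young} (Yx x2) (Yy y2).
set yx := k * (x * _); set yy := k * (_ * _) => Yx Yy.
set rhs := (X in _ <= X).
have -> : rhs = 2 * k * w ^+ 2 +
    (k ^+ 2 * c ^+ 2 / eps * w ^+ 2 + eps * D1 ^+ 2) +
    (k ^+ 2 * h ^+ 2 / eps * w ^+ 2 + eps * D2 ^+ 2) by rewrite /rhs; ring.
rewrite !mulrDr -/yx -/yy.
have -> : k * w ^+ 2 + yx + (k * w ^+ 2 + yy) = 2 * k * w ^+ 2 + yx + yy.
  by ring.
by rewrite lerD// lerD.
Qed.

Lemma ge0_integral_combination d (T : measurableType d) (R : realType)
    (mu : {measure set T -> \bar R}) (D : set T) (f1 f2 : T -> R) (k1 k2 : R) :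
  measurable D -> measurable_fun D f1 -> measurable_fun D f2 ->
  (forall x, 0 <= f1 x) -> (forall x, 0 <= f2 x) -> 0 <= k1 -> 0 <= k2 ->
  (\int[mu]_(x in D) (k1 * f1 x + k2 * f2 x)%:E =
   k1%:E * \int[mu]_(x in D) (f1 x)%:E + k2%:E * \int[mu]_(x in D) (f2 x)%:E)%E.
Proof.
move=> mD /measurable_EFinP m1 /measurable_EFinP m2 p1 p2 k10 k20.
have e1 x : D x -> (0 <= (f1 x)%:E)%E by rewrite lee_fin.
have e2 x : D x -> (0 <= (f2 x)%:E)%E by rewrite lee_fin.
rewrite -!ge0_integralZl_EFin// -ge0_integralD//.
- by move=> x _; rewrite -EFinM lee_fin mulr_ge0.
- exact: measurable_funeM.
- by move=> x _; rewrite -EFinM lee_fin mulr_ge0.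
- exact: measurable_funeM.
Qed.

(** Replaces the triangle inequality for the L^2 norm in the passage to the
limit, without square roots: [x^2 <= 2 y^2 + 2 (y - x)^2]. *)
Lemma integral_le_double d (T : measurableType d) (R : realType)
    (mu : {measure set T -> \bar R}) (D : set T) (f0 f1 f2 : T -> R) :
  measurable D -> measurable_fun D f0 -> measurable_fun D f1 ->
  measurable_fun D f2 ->
  (forall x, 0 <= f0 x) -> (forall x, 0 <= f1 x) -> (forall x, 0 <= f2 x) ->
  (forall x, D x -> f0 x <= 2 * f1 x + 2 * f2 x) ->
  (\int[mu]_(x in D) (f0 x)%:E <=
   2%:E * \int[mu]_(x in D) (f1 x)%:E + 2%:E * \int[mu]_(x in D) (f2 x)%:E)%E.
Proof.
move=> mD m0 m1 m2 p0 p1 p2 f012.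
rewrite -ge0_integral_combination//; apply: ge0_le_integral => //.
- by move=> x _; rewrite lee_fin.
- exact/measurable_EFinP.
- by apply/measurable_EFinP; apply: measurable_funD; exact: measurable_funM.
Qed.

(** The trace inequality in [H^1]: the boundary integral of [w^2] is compared
with that of [v_n^2], the trace inequality is applied to the smooth [v_n], and
[v_n] is compared with [u], each comparison costing a factor 2 and an error
term that tends to 0.  This is why [eps / 4] is used for the smooth
functions. *)
Lemma trace_bound (R : realType) (c h eps : R) :
  0 < c -> 0 < h -> 0 < eps ->
  let A := (- c, 0) in let B := (c, 0) in let C := (0, h) in
  exists2 K : R, 0 <= K & forall u g1 g2 w : R * R -> R,
    H1_with_gradient (triangle A B C) u g1 g2 ->
    is_trace (triangle A B C) (triangle_boundary_measure A B C) u g1 g2 w ->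
    (\int[triangle_boundary_measure A B C]_p (w p ^+ 2)%:E <=
     (K * \int[area]_(p in triangle A B C) (u p ^+ 2) +
      eps * \int[area]_(p in triangle A B C) (g1 p ^+ 2 + g2 p ^+ 2))%:E)%E.
Proof.
move=> c0 h0 eps0 A B C; set T := triangle A B C.
set sigma := triangle_boundary_measure A B C.
have eps40 : 0 < eps / 4 by exact: divr_gt0.
have [K K0 trace] := trace_inequality c0 h0 eps40.
exists (4 * K); first exact: mulr_ge0.
move=> u g1 g2 w [[mu iu] [[mg1 ig1] [mg2 ig2]] _ _] [[mw _] [v [sv vu vg vw]]].
have mT : measurable (T : set (plane R)) by exact: measurable_triangle.
have sq0 (f : R * R -> R) p : 0 <= f p ^+ 2 by exact: sqr_ge0.
have mv n : measurable_fun setT (v n : plane R -> R).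
  by have [cv _ _ _] := sv n 1%N; exact: measurable_fun_plane cv.
have mv1 n : measurable_fun setT ('D_(1, 0) (v n) : plane R -> R).
  by have [_ _ cv1 _] := sv n 1%N; exact: measurable_fun_plane cv1.
have mv2 n : measurable_fun setT ('D_(0, 1) (v n) : plane R -> R).
  by have [_ _ _ cv2] := sv n 1%N; exact: measurable_fun_plane cv2.
have msq D (f : plane R -> R) : measurable_fun D f ->
    measurable_fun D (fun p => f p ^+ 2).
  exact: measurable_funX.
have young (x y : R) : x ^+ 2 <= 2 * y ^+ 2 + 2 * (y - x) ^+ 2.
  have := sqr_ge0 (x - 2 * y); nra.
set U := (\int[area]_(p in T) (u p ^+ 2)%:E)%E.
set G := (\int[area]_(p in T) (g1 p ^+ 2 + g2 p ^+ 2)%:E)%E.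
pose a n := (\int[area]_(p in T) ((v n p - u p) ^+ 2)%:E)%E.
pose b n := (\int[area]_(p in T) (('D_(1, 0) (v n) p - g1 p) ^+ 2 +
  ('D_(0, 1) (v n) p - g2 p) ^+ 2)%:E)%E.
pose e n := (\int[sigma]_p ((v n p - w p) ^+ 2)%:E)%E.
have wv n : (\int[sigma]_p (w p ^+ 2)%:E <=
    2%:E * \int[sigma]_p (v n p ^+ 2)%:E + 2%:E * e n)%E.
  apply: integral_le_double => //; [exact: msq|exact: msq| |].
    by apply: msq; exact: measurable_funB.
  by move=> p; exact: sqr_ge0.
have vT n : (\int[area]_(p in T) (v n p ^+ 2)%:E <=
    2%:E * U + 2%:E * a n)%E.
  have mvT : measurable_fun T (v n : plane R -> R).
    by apply: measurable_funTS; exact: mv.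
  apply: integral_le_double => //; [exact: msq|exact: msq| | |].
  - by apply: msq; exact: measurable_funB.
  - by move=> p; exact: sqr_ge0.
  move=> p _; have := young (v n p) (u p).
  by rewrite -(sqrrN (u p - v n p)) opprB.
have vgT n : (\int[area]_(p in T)
    ('D_(1, 0) (v n) p ^+ 2 + 'D_(0, 1) (v n) p ^+ 2)%:E <=
    2%:E * G + 2%:E * b n)%E.
  have mv1T : measurable_fun T ('D_(1, 0) (v n) : plane R -> R).
    by apply: measurable_funTS; exact: mv1.
  have mv2T : measurable_fun T ('D_(0, 1) (v n) : plane R -> R).
    by apply: measurable_funTS; exact: mv2.
  apply: integral_le_double => //.
  - by apply: measurable_funD; exact: msq.
  - by apply: measurable_funD; exact: msq.
  - by apply: measurable_funD; apply: msq; exact: measurable_funB.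
  - by move=> p; rewrite addr_ge0 ?sqr_ge0.
  - by move=> p; rewrite addr_ge0 ?sqr_ge0.
  - by move=> p; rewrite addr_ge0 ?sqr_ge0.
  move=> p _; have y1 := young ('D_(1, 0) (v n) p) (g1 p).
  have y2 := young ('D_(0, 1) (v n) p) (g2 p).
  rewrite -[('D_(1, 0) (v n) p - _) ^+ 2]sqrrN.
  rewrite -[('D_(0, 1) (v n) p - _) ^+ 2]sqrrN.
  by rewrite !opprB; lra.
have sigmaT n : (\int[sigma]_p (v n p ^+ 2)%:E <=
    K%:E * \int[area]_(p in T) (v n p ^+ 2)%:E +
    (eps / 4)%:E * \int[area]_(p in T)
      ('D_(1, 0) (v n) p ^+ 2 + 'D_(0, 1) (v n) p ^+ 2)%:E)%E.
  have mv1T : measurable_fun T ('D_(1, 0) (v n) : plane R -> R).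
    by apply: measurable_funTS; exact: mv1.
  have mv2T : measurable_fun T ('D_(0, 1) (v n) : plane R -> R).
    by apply: measurable_funTS; exact: mv2.
  have mvT : measurable_fun T (v n : plane R -> R).
    by apply: measurable_funTS; exact: mv.
  apply: le_trans (trace (v n) (sv n 1)) _.
  rewrite ge0_integral_combination//; [exact: msq| | |exact: ltW].
    by apply: measurable_funD; exact: msq.
  by move=> p; rewrite addr_ge0 ?sqr_ge0.
have small (x : nat -> \bar R) (d : R) : 0 < d ->
    x @ \oo --> 0%E -> \forall n \near \oo, (x n < d%:E)%E.
  move=> d0 x0; apply: (x0 [set y | (y < d%:E)%E]).
  apply: open_nbhs_nbhs; split; first exact: open_ereal_lt_ereal.
  by rewrite /= lte_fin.
apply/lee_addgt0Pr => d d0.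
(* If the three errors are below r, the total error is
   2 (K 2 r + (eps / 4) 2 r) + 2 r = (4 K + eps + 2) r. *)
pose r := d / (4 * K + eps + 2).
have den0 : 0 < 4 * K + eps + 2 by lra.
have r0 : 0 < r by exact: divr_gt0.
have [n [an bn en]] : exists n,
    [/\ (a n < r%:E)%E, (b n < r%:E)%E & (e n < r%:E)%E].
  near \oo => n; exists n; split; near: n; exact: small.
have U0 : (0 <= U)%E by apply: integral_ge0 => p _; rewrite lee_fin.
have G0 : (0 <= G)%E.
  by apply: integral_ge0 => p _; rewrite lee_fin addr_ge0.
have {}vT : (\int[area]_(p in T) (v n p ^+ 2)%:E <= 2%:E * U + (2 * r)%:E)%E.
  apply: le_trans (vT n) _; rewrite leeD2l// EFinM lee_pmul2l ?lte_fin//.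
  exact: ltW.
have {}vgT : (\int[area]_(p in T)
    ('D_(1, 0) (v n) p ^+ 2 + 'D_(0, 1) (v n) p ^+ 2)%:E <=
    2%:E * G + (2 * r)%:E)%E.
  apply: le_trans (vgT n) _; rewrite leeD2l// EFinM lee_pmul2l ?lte_fin//.
  exact: ltW.
have {}en : (2%:E * e n <= (2 * r)%:E)%E.
  by rewrite EFinM lee_pmul2l ?lte_fin// ltW.
have Ufin : U \is a fin_num by rewrite ge0_fin_numE.
have Gfin : G \is a fin_num.
  rewrite ge0_fin_numE// /G.
  under eq_integral do rewrite -[g1 _ ^+ 2]mul1r -[g2 _ ^+ 2]mul1r.
  rewrite ge0_integral_combination//; [|exact: msq..].
  by rewrite !mul1e lte_add_pinfty.
rewrite /Rintegral -/U -/G; move: vT vgT (sigmaT n) (wv n) en U0 G0.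
rewrite -(fineK Ufin) -(fineK Gfin) -!EFinM -!EFinD.
set X := fine U; set Y := fine G.
set vI := (\int[area]_(p in T) (v n p ^+ 2)%:E)%E.
set gI := (\int[area]_(p in T) ('D_(1, 0) (v n) p ^+ 2 + _)%:E)%E.
set sI := (\int[sigma]_p (v n p ^+ 2)%:E)%E.
move=> vT vgT sigmaI wI en; rewrite !lee_fin => X0 Y0.
have {}sigmaI : (sI <= (K * (2 * X + 2 * r) + eps / 4 * (2 * Y + 2 * r))%:E)%E.
  apply: le_trans sigmaI _; rewrite EFinD !EFinM; apply: leeD.
    by apply: lee_wpmul2l; rewrite ?lee_fin.
  by apply: lee_wpmul2l; rewrite ?lee_fin// ltW.
apply: le_trans wI _.
apply: (@le_trans _ _ ((2 * (K * (2 * X + 2 * r) + eps / 4 * (2 * Y + 2 * r))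
   + 2 * r)%:E)).
  rewrite (EFinD (2 * _)) (EFinM 2).
  by apply: leeD en; apply: lee_wpmul2l.
rewrite lee_fin /=.
have dE : d = (4 * K + eps + 2) * r.
  by rewrite /r mulrC divfK// gt_eqF.
rewrite le_eqVlt dE; apply/orP; left; apply/eqP.
by field.
Unshelve. all: end_near.
Qed.

(** * Bounds for the Robin eigenvalue *)
(** With [eps = 1 / |alpha|] the gradient part of the boundary term is exactly
cancelled, which leaves the lower bound [alpha * K]. *)
Lemma robin_eigenvalue_ge (R : realType) (c h alpha : R) :
  0 < c -> 0 < h -> alpha < 0 ->
  let A := (- c, 0) in let B := (c, 0) in let C := (0, h) in
  exists M : R, (M%:E <= robin_eigenvalue (triangle A B C)
                            (triangle_boundary_measure A B C) alpha)%E.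
Proof.
move=> c0 h0 alpha0 A B C.
have eps0 : 0 < (- alpha)^-1 by rewrite invr_gt0 oppr_gt0.
have [K K0 bound] := trace_bound c0 h0 eps0.
exists (alpha * K); apply: le_ereal_inf_tmp.
move=> _ [u [g1 [g2 [w [H1u _ tr ->]]]]].
rewrite lee_fin; have := bound u g1 g2 w H1u tr.
rewrite -/A -/B -/C; set W := (X in (X <= _)%E).
set Wr := (X in _ + alpha * X); rewrite (_ : Wr = fine W)//.
set U := (X in K * X + _); set G := (X in X + alpha * fine W) => WUG.
have U0 : 0 <= U by apply: Rintegral_ge0 => p _; exact: sqr_ge0.
have W0 : (0 <= W)%E by apply: integral_ge0 => p _; rewrite lee_fin sqr_ge0.
have Wfin : W \is a fin_num by rewrite ge0_fin_numE// (le_lt_trans WUG)// ltry.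
have {}WUG : fine W <= K * U + (- alpha)^-1 * G.
  by rewrite -lee_fin fineK.
rewrite -[X in _ / X]/U.
have num : alpha * K * U <= G + alpha * fine W.
  have -> : alpha * K * U = G + alpha * (K * U + (- alpha)^-1 * G).
    by field; rewrite lt_eqF.
  by rewrite lerD2l ler_nM2l.
have [U00|] := eqVneq U 0.
  (* Division by 0 gives 0, which is above the bound since alpha K <= 0. *)
  by rewrite U00 invr0 mulr0 nmulr_rle0.
rewrite neq_lt ltNge U0/= => Upos.
by rewrite ler_pdivlMr.
Qed.

Lemma test_function_eq0 (R : realType) (Omega : set (R * R))
    (phi : R * R -> R) (p : R * R) :
  test_function Omega phi -> ~ Omega p -> phi p = 0.
Proof.
move=> [_ _ sub] nOp; apply: contrapT => /eqP phip; apply: nOp.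
by apply: sub; exact: subset_closure.
Qed.

Lemma test_function_derive_eq0 (R : realType) (Omega : set (R * R))
    (phi : R * R -> R) (e p : R * R) :
  test_function Omega phi -> ~ Omega p -> 'D_e phi p = 0.
Proof.
move=> [_ _ sub] nOp.
rewrite (@near_eq_derive _ _ _ _ (cst 0))//; first exact: derive_cst.
have : open (~` closure [set p | phi p != 0]).
  by rewrite openC; exact: closed_closure.
rewrite openE => /(_ p) near0.
have : ~ closure [set p | phi p != 0] p by move=> /sub.
move=> /near0; apply: filterS => q nq.
by apply: contrapT => /eqP phiq; apply: nq; exact: subset_closure.
Qed.

(** Extending a test function by zero to a large square does not change the
integral of its derivative, and there the divergence lemmas give boundary
terms that vanish.  This makes 0 a weak gradient of a constant. *)
Lemma integral_test_derivative (R : realType) (Omega : set (R * R))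
    (phi : R * R -> R) (e : R * R) :
  bounded_plane Omega -> e = (1, 0) \/ e = (0, 1) ->
  test_function Omega phi -> (\int[area]_(p in Omega) ('D_e phi p)%:E = 0)%E.
Proof.
move=> [M OM] eE tphi; have [sphi _ _] := tphi.
have [_ dphi c1 c2] := sphi 1%N.
pose N := `|M| + 1; have MN : M < N by rewrite /N ltr_pwDr// ler_norm.
pose box : set (R * R) := `]- N, N[ `*` `]- N, N[.
have Obox p : Omega p -> box p.
  by move=> /OM[/=]; rewrite /box/= !in_itv/=; move=> /andP[? ?] /andP[? ?];
    split; apply/andP; split; lra.
have mbox : measurable (box : set (plane R)) by exact: measurableX.
have bbox : bounded_plane box.
  by exists N => p [/= p1 p2]; split; apply: subset_itv_oo_cc.
have phi0 p : ~ box p -> phi p = 0.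
  by move=> nbox; apply: test_function_eq0 tphi _ => /Obox.
transitivity (\int[area]_(p in box) ('D_e phi p)%:E)%E.
  rewrite integral_mkcond [RHS]integral_mkcond.
  apply: eq_integral => p _; rewrite /patch.
  case: ifPn => [|]; rewrite ?inE ?notin_setE => Op.
    by rewrite ifT// inE; exact: Obox.
  by rewrite (test_function_derive_eq0 e tphi Op); case: ifP.
have outx y : phi (N, y) - phi (- N, y) = 0.
  by rewrite !phi0 ?subrr// => -[]/=; rewrite in_itv/= ?ltxx ?andbF.
have outy x : phi (x, N) - phi (x, - N) = 0.
  by rewrite !phi0 ?subrr// => -[]/=; rewrite !in_itv/= ?ltxx ?andbF.
have NN : - N <= N.
  have := normr_ge0 M; rewrite /N; lra.
case: eE => ->.
  rewrite (divergence_rows (a := - N) (b := N) (l := fun=> - N)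
    (r := fun=> N) mbox bbox c1 (fun x y => is_derive_row (dphi (x, y)).1))//.
    by apply: integral0_eq => y _; rewrite outx.
  by move=> x y; rewrite /box/= !in_itv/=; split => -[].
rewrite (divergence_cols (a := - N) (b := N) (l := fun=> - N)
  (r := fun=> N) mbox bbox c2 (fun x y => is_derive_col (dphi (x, y)).2))//.
by apply: integral0_eq => x _; rewrite outy.
Qed.

Lemma smooth_cst (R : realType) (k : R) : smooth (fun _ : R * R => k).
Proof.
move=> n; elim: n k => [|n IHn] k /=; first exact: cst_continuous.
have D0 e : 'D_e (fun _ : R * R => k) = (fun=> 0).
  by apply/funext => p; exact: derive_cst.
by rewrite !D0; split => //; exact: cst_continuous.
Qed.

(** The Rayleigh quotient of the constant function 1, which is its own
approximating sequence for the trace. *)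
Lemma robin_eigenvalue_le (R : realType) (a c h alpha : R) (A B C : R * R) :
  0 < c -> 0 < h -> A = (- c, 0) -> B = (c, 0) -> C = (a, h) ->
  (robin_eigenvalue (triangle A B C) (triangle_boundary_measure A B C) alpha <=
   (alpha * (segment_length A B + segment_length B C + segment_length C A) /
      (c * h))%:E)%E.
Proof.
move=> c0 h0 AE BE CE.
have mT : measurable (triangle A B C : set (plane R)).
  by rewrite AE BE CE; exact: measurable_triangle.
have bT : bounded_plane (triangle A B C).
  by rewrite AE BE CE; exact: bounded_triangle.
have aT : area (triangle A B C) = (c * h)%:E by rewrite AE BE CE area_triangle.
have sigma1 : (\int[triangle_boundary_measure A B C]_p (1 : R)%:E =
    (segment_length A B + segment_length B C + segment_length C A)%:E)%E.
  rewrite (@integral_triangle_boundary _ _ _ _ (fun=> 1))//.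
  rewrite !(@integral_segment _ _ _ (fun=> 1))//; try exact: cst_continuous.
  rewrite -!EFinD Rintegral_cst//= lebesgue_measure_itv/= lte_fin ltr01.
  by rewrite oppr0 adde0 /= !mulr1.
have area1 : (\int[area]_(p in triangle A B C) (1 : R)%:E = (c * h)%:E)%E.
  by rewrite -[LHS]/(\int[area]_(p in triangle A B C) (cst 1%:E p))%E
    integral_cst// mul1e.
have weak0 e : e = (1, 0) \/ e = (0, 1) ->
    weak_derivative (triangle A B C) e (fun=> 1) (fun=> 0).
  move=> eE phi tphi; rewrite /Rintegral.
  under eq_integral do rewrite mul1r.
  rewrite (integral_test_derivative bT eE tphi).
  by under eq_integral do rewrite mul0r; rewrite integral0 oppr0.
apply: ereal_inf_lbound.
exists (fun=> 1), (fun=> 0), (fun=> 0), (fun=> 1); split.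
- split.
  + by split; [exact: measurable_cst|rewrite expr1n area1 ltry].
  + by split; (split; [exact: measurable_cst|rewrite expr0n/= integral0 ltry]).
  + exact: (weak0 _ (or_introl erefl)).
  + exact: (weak0 _ (or_intror erefl)).
- move=> [N [mN N0 TN]].
  have : (area (triangle A B C) <= area N)%E.
    apply: le_measure; rewrite ?inE// => p Tp; apply: TN => /(_ Tp).
    by move/eqP; rewrite oner_eq0.
  by rewrite N0 aT lee_fin leNgt mulr_gt0.
- split; first by split; [exact: measurable_cst|rewrite expr1n sigma1 ltry].
  exists (fun _ _ => 1); split.
  + by move=> n; exact: smooth_cst.
  + by rewrite subrr expr0n/= integral0; exact: cvg_cst.
  + rewrite (_ : (fun n => _) = fun=> 0%E); first exact: cvg_cst.
    apply/funext => n; apply: integral0_eq => p _.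
    by rewrite !derive_cst subrr expr0n/= addr0.
  + by rewrite subrr expr0n/= integral0; exact: cvg_cst.
- rewrite /Rintegral expr1n expr0n/= addr0 integral0 sigma1 area1/=.
  by rewrite add0r.
Qed.

Theorem theorem5p1 (R : realType) (S : R) (hS : 0 < S)
    (alpha : R) (halpha : alpha < 0) :
  exists a1 c1 c2 : R,
    [/\ 0 < a1, 0 < c1 & 0 < c2] /\
    [/\ forall a c : R, a1 < `|a| -> 0 < c ->
           (lambda S alpha a c < lambda_equilateral S alpha)%E,
        forall a c : R, c1 < c ->
           (lambda S alpha a c < lambda_equilateral S alpha)%E
      & forall a c : R, 0 < c -> c < c2 ->
           (lambda S alpha a c < lambda_equilateral S alpha)%E].
Proof.
pose c0 := Num.sqrt (S / Num.sqrt 3).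
have c00 : 0 < c0 by rewrite sqrtr_gt0 divr_gt0// sqrtr_gt0.
have [M lower] := robin_eigenvalue_ge c00 (divr_gt0 hS c00) halpha.
(* alpha P / S <= M would suffice; adding 1 makes P positive and leaves room. *)
pose P := `|M| * S / - alpha + 1.
have P0 : 0 < P.
  by rewrite ltr_pwDr// divr_ge0 ?mulr_ge0 ?oppr_ge0// ltW.
have perimeter a c : 0 < c ->
    P < segment_length (- c, 0) (c, 0) + segment_length (c, 0) (a, S / c) +
        segment_length (a, S / c) (- c, 0) ->
    (lambda S alpha a c < lambda_equilateral S alpha)%E.
  move=> c_gt0 Plt; apply: lt_le_trans lower.
  have Sc_gt0 := divr_gt0 hS c_gt0.
  apply: le_lt_trans
    (robin_eigenvalue_le alpha c_gt0 Sc_gt0 erefl erefl erefl) _.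
  set L := _ + _ + _ in Plt *.
  rewrite lte_fin (_ : c * (S / c) = S); last by field; rewrite gt_eqF.
  rewrite ltr_pdivrMr//.
  have PE : alpha * P = alpha - `|M| * S by rewrite /P; field; rewrite lt_eqF.
  have LP : alpha * L < alpha * P by rewrite ltr_nM2l.
  have MM : - `|M| * S <= M * S.
    by rewrite ler_pM2r// lerNl -normrN ler_norm.
  lra.
have length_ge1 (A B : R * R) : `|B.1 - A.1| <= segment_length A B.
  by rewrite -sqrtr_sqr ler_wsqrtr// lerDl sqr_ge0.
have length_ge2 (A B : R * R) : `|B.2 - A.2| <= segment_length A B.
  by rewrite -sqrtr_sqr ler_wsqrtr// lerDr sqr_ge0.
exists P, P, (S / P); split; first by split => //; exact: divr_gt0.
have length_ge0 (A B : R * R) : 0 <= segment_length A B.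
  exact: segment_length_ge0.
split => [a c aP c_gt0|a c cP|a c c_gt0 cP].
- apply: perimeter => //; apply: lt_le_trans aP _.
  have := length_ge0 (- c, 0) (c, 0).
  have := length_ge1 (c, 0) (a, S / c).
  have := length_ge1 (a, S / c) (- c, 0).
  have := ler_norm (a - c); have := ler_norm (- (a - c)); rewrite normrN.
  have := ler_norm (- c - a); have := ler_norm (- (- c - a)); rewrite normrN /=.
  by case: (ger0P a) => a0; lra.
- have c_gt0 := lt_trans P0 cP; apply: perimeter => //.
  have := length_ge1 (- c, 0) (c, 0) => /=.
  have := length_ge0 (c, 0) (a, S / c).
  have := length_ge0 (a, S / c) (- c, 0).
  by have := ler_norm (c - - c); lra.
- apply: perimeter => //.
  have := length_ge0 (- c, 0) (c, 0).
  have := length_ge2 (c, 0) (a, S / c) => /=.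
  have := length_ge0 (a, S / c) (- c, 0).
  have Pc : P < S / c by rewrite ltr_pdivlMr// mulrC -ltr_pdivlMr.
  by have := ler_norm (S / c - 0); lra.
Qed.
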